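(* Let $$C=\inf\{r(f): f \text{ is slice regular on } \mathbb{B} \text{ such that } f'(0)=1 \text{ and } f(\mathbb{B}) \text{ is convex}\}.$$ Then $$\frac12\leq C\leq\frac{\pi}{4}.$$
   Context: $\mathbb{H}\cong\mathbb{R}^4$ denotes the quaternions, $\mathbb{B}=\{q\in\mathbb{H}:|q|<1\}$, $\mathbb{S}=\{q\in\mathbb{H}:q^2=-1\}$; for $I\in\mathbb{S}$, $\mathbb{C}_I=\mathbb{R}\oplus I\mathbb{R}$ and $\mathbb{B}_I=\mathbb{B}\cap\mathbb{C}_I$. A function $f:\mathbb{B}\to\mathbb{H}$ is (left) slice regular if for every $I\in\mathbb{S}$ the restriction $f_I=f|_{\mathbb{B}_I}$ has continuous partial derivatives and $\frac12\left(\frac{\partial}{\partial x}+I\frac{\partial}{\partial y}\right)f_I(x+yI)=0$ on $\mathbb{B}_I$; equivalently $f(q)=\sum_{n\ge0}q^na_n$ on $\mathbb{B}$ with $a_n\in\mathbb{H}$. Its slice derivative is $f'(x+yI)=\frac12\left(\frac{\partial}{\partial x}-I\frac{\partial}{\partial y}\right)f_I(x+yI)$, i.e. $f'(q)=\sum_{n\ge1}q^{n-1}na_n$. For $a\in\mathbb{B}$ and a slice regular function $f$ on $\mathbb{B}$ with $f'(0)=1$, $r(a,f)$ denotes the radius (possibly $+\infty$) of the largest ball centered at $f(a)$ contained in the image $f(\mathbb{B})$, and $r(f)=\sup\{r(a,f):a\in\mathbb{B}\}$. *)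

(* Defs.v *)
From Stdlib Require Import Reals Lra.
From Coquelicot Require Import Coquelicot.

Open Scope R_scope.

(* (a, b, c, d) is a + b i + c j + d k.  The additive group, the real vector
   space structure and the norm are Coquelicot's ones on iterated products,
   which are the Euclidean ones of R^4 (see [Hmod_norm]). *)
Definition quaternion : Type := (R * R * R * R)%type.

Declare Scope quaternion_scope.
Delimit Scope quaternion_scope with H.
Bind Scope quaternion_scope with quaternion.

Definition RtoH (x : R) : quaternion := (x, 0, 0, 0).

Definition Hplus (p q : quaternion) : quaternion :=
  let '(a, b, c, d) := p in
  let '(a', b', c', d') := q in
  (a + a', b + b', c + c', d + d').

Definition Hopp (p : quaternion) : quaternion :=
  let '(a, b, c, d) := p in (- a, - b, - c, - d).

Definition Hmult (p q : quaternion) : quaternion :=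
  let '(a, b, c, d) := p in
  let '(a', b', c', d') := q in
  (a * a' - b * b' - c * c' - d * d',
   a * b' + b * a' + c * d' - d * c',
   a * c' - b * d' + c * a' + d * b',
   a * d' + b * c' - c * b' + d * a').

Definition Hmod (p : quaternion) : R :=
  let '(a, b, c, d) := p in sqrt (a ^ 2 + b ^ 2 + c ^ 2 + d ^ 2).

Infix "+" := Hplus : quaternion_scope.
Infix "*" := Hmult : quaternion_scope.
Notation "- p" := (Hopp p) : quaternion_scope.
Notation "p - q" := (Hplus p (Hopp q)) : quaternion_scope.

Lemma Hmod_norm (p : quaternion) : Hmod p = norm p.
Proof.
  destruct p as [[[a b] c] d]; unfold norm; simpl; unfold prod_norm; simpl.
  unfold norm; simpl; unfold prod_norm; simpl.
  unfold norm; simpl; unfold prod_norm; simpl.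
  unfold norm; simpl; unfold abs; simpl.
  assert (Hs : forall t : R, Rabs t * (Rabs t * 1) = t ^ 2)
    by (intros t; rewrite <- (pow2_abs t); ring).
  rewrite !Hs, !Rmult_1_r, !sqrt_sqrt by (try rewrite sqrt_sqrt; nra).
  f_equal; ring.
Qed.

Definition unit_ball (q : quaternion) : Prop := Hmod q < 1.

Definition imaginary_unit (I : quaternion) : Prop := (I * I = - RtoH 1)%H.

(* The point x + y I of the slice C_I. *)
Definition slice_point (I : quaternion) (x y : R) : quaternion :=
  (RtoH x + RtoH y * I)%H.

(* l is the partial derivative at (x, y) of f_I with respect to x, resp. y. *)
Definition is_slice_dx (f : quaternion -> quaternion) (I : quaternion)
    (x y : R) (l : quaternion) : Prop :=
  is_derive (fun t : R => f (slice_point I t y)) x l.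

Definition is_slice_dy (f : quaternion -> quaternion) (I : quaternion)
    (x y : R) (l : quaternion) : Prop :=
  is_derive (fun t : R => f (slice_point I x t)) y l.

(* Functions on the unit ball are represented by total functions; since the
   ball is open, only the values on the ball matter here and below. *)
Definition slice_regular (f : quaternion -> quaternion) : Prop :=
  forall I : quaternion, imaginary_unit I ->
  exists fx fy : R * R -> quaternion,
  forall x y : R, unit_ball (slice_point I x y) ->
    is_slice_dx f I x y (fx (x, y)) /\
    is_slice_dy f I x y (fy (x, y)) /\
    continuous fx (x, y) /\
    continuous fy (x, y) /\
    (RtoH (1 / 2) * (fx (x, y) + I * fy (x, y)) = RtoH 0)%H.

(* f'(q) = d, for every way of writing q = x + y I: a real q lies on all the
   slices C_I, and they are all required to give the same value d. *)
Definition is_slice_derivative (f : quaternion -> quaternion)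
    (q d : quaternion) : Prop :=
  forall (I : quaternion) (x y : R),
    imaginary_unit I -> q = slice_point I x y ->
    exists lx ly : quaternion,
      is_slice_dx f I x y lx /\
      is_slice_dy f I x y ly /\
      d = (RtoH (1 / 2) * (lx - I * ly))%H.

Definition image_ball (f : quaternion -> quaternion) (w : quaternion) : Prop :=
  exists q : quaternion, unit_ball q /\ f q = w.

Definition convex (A : quaternion -> Prop) : Prop :=
  forall (p q : quaternion) (t : R), A p -> A q -> 0 <= t <= 1 ->
    A (RtoH (1 - t) * p + RtoH t * q)%H.

(* r(a, f).  The balls are open, so the supremum of the admissible radii is
   itself admissible when finite; radius 0 (the empty ball) makes the value 0
   when f(a) is not an interior point of the image. *)
Definition radius_at (a : quaternion) (f : quaternion -> quaternion) : Rbar :=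
  Lub_Rbar (fun rho : R => 0 <= rho /\
    forall w : quaternion, Hmod (w - f a)%H < rho -> image_ball f w).

Definition radius (f : quaternion -> quaternion) : Rbar :=
  Rbar_lub (fun r : Rbar =>
    exists a : quaternion, unit_ball a /\ r = radius_at a f).

Definition convex_bloch_constant : Rbar :=
  Rbar_glb (fun r : Rbar =>
    exists f : quaternion -> quaternion,
      slice_regular f /\ is_slice_derivative f (RtoH 0) (RtoH 1) /\
      convex (image_ball f) /\ r = radius f).

(* Main.v *)
Require Import Defs.
From Stdlib Require Import Reals Lra Psatz Classical IndefiniteDescription.
From Coquelicot Require Import Coquelicot.

(* Lower bound.  If a convex set does not contain the ball of radius 1/2 about
   f(0), some closed half-space <n, .> <= M contains it and leaves less than
   1/2 of room at f(0).  Pick a slice C_I containing n.  On its disk <n, f> is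
   harmonic, since f_y = I f_x makes <n, f> and <I n, f> harmonic conjugates,
   and its gradient at 0 is n, of norm 1, because f'(0) = 1.  Harnack's
   inequality at the centre then gives 1 <= 2 (M - <n, f(0)>).

   Upper bound.  The slice extension of artanh maps the ball onto
   {|Im w| < PI / 4}, a convex set containing no ball of radius > PI / 4. *)

Open Scope R_scope.

(** * Conjugate harmonic functions on the disk *)

(** Harnack's inequality at the centre needs only the Fourier modes 0 and 1 on circles, so no
    Poisson kernel is built. The integral [F(r)] of the conjugate pair against the mode [k]
    satisfies the Euler equation [r F' = k F]: the Cauchy-Riemann equations trade radial derivatives
    for angular ones, which integrate by parts over a period. Differentiability at [r = 0] then
    selects the solution: constant for [k = 0], linear for [k = 1], zero for [k = -1]. The constant
    1/2 is the ratio of the masses [PI] and [2 * PI] carried by the modes 1 and 0.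

    On the convex side, the image is not known to be closed. Separation therefore only shows that
    the image is dense in the ball, and a further argument, on the 16 orthants around a point, turns
    density into containment. *)

Lemma is_derive_continuous (f : R -> R) (x l : R) :
  is_derive f x l -> continuous f x.
Proof.
  intros H; apply (ex_derive_continuous (K := R_AbsRing) (V := R_NormedModule)).
  now exists l.
Qed.

Record cauchy_riemann_at (u v ux uy : R -> R -> R) (x y : R) : Prop := {
  cr_dxu : is_derive (fun t => u t y) x (ux x y);
  cr_dyu : is_derive (u x) y (uy x y);
  cr_dxv : is_derive (fun t => v t y) x (- uy x y);
  cr_dyv : is_derive (v x) y (ux x y);
  cr_ux : continuity_2d_pt ux x y;
  cr_uy : continuity_2d_pt uy x y }.

Definition cauchy_riemann (u v ux uy : R -> R -> R) : Prop :=
  forall x y, x ^ 2 + y ^ 2 < 1 -> cauchy_riemann_at u v ux uy x y.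

Lemma locally_disk (x y : R) : x ^ 2 + y ^ 2 < 1 ->
  locally (x, y) (fun p : R * R => fst p ^ 2 + snd p ^ 2 < 1).
Proof.
  intros H.
  assert (C : continuous (fun p : R * R => fst p ^ 2 + snd p ^ 2) (x, y)).
  { assert (Sq : forall t : R, continuous (fun s : R => s ^ 2) t).
    { intros t; apply (is_derive_continuous _ _ (2 * t)).
      auto_derive; [easy | ring]. }
    apply (continuous_plus (fun p : R * R => fst p ^ 2)
                           (fun p : R * R => snd p ^ 2)).
    - apply (continuous_comp fst (fun s : R => s ^ 2));
        [apply continuous_fst | apply Sq].
    - apply (continuous_comp snd (fun s : R => s ^ 2));
        [apply continuous_snd | apply Sq]. }
  exact (C _ (open_lt 1 _ H)).
Qed.

(** Total differentiability is what the chain rule along polar coordinates requires. It follows from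
    continuity of one partial derivative at the point together with existence of the other. *)
Lemma C1_differentiable (u ux uy : R -> R -> R) (x y : R) :
  x ^ 2 + y ^ 2 < 1 ->
  (forall x y, x ^ 2 + y ^ 2 < 1 -> is_derive (fun t => u t y) x (ux x y)) ->
  is_derive (u x) y (uy x y) -> continuity_2d_pt ux x y ->
  differentiable_pt_lim u x y (ux x y) (uy x y).
Proof.
  intros Hxy Hx Hy Hc.
  apply filterdiff_differentiable_pt_lim.
  apply (is_derive_filterdiff u x y ux (uy x y)).
  - generalize (locally_disk x y Hxy); apply filter_imp.
    intros [a b] H; exact (Hx a b H).
  - exact Hy.
  - now apply continuity_2d_pt_filterlim.
Qed.

Lemma continuity_2d_pt_comp (f g h : R -> R -> R) (x y : R) :
  continuity_2d_pt f (g x y) (h x y) ->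
  continuity_2d_pt g x y -> continuity_2d_pt h x y ->
  continuity_2d_pt (fun a b => f (g a b) (h a b)) x y.
Proof.
  rewrite !continuity_2d_pt_filterlim; intros Hf Hg Hh.
  apply (continuous_comp_2 (fun z : R * R => g (fst z) (snd z))
    (fun z : R * R => h (fst z) (snd z)) f (x, y) Hg Hh Hf).
Qed.

Lemma continuity_2d_pt_snd (f : R -> R) (x y : R) :
  continuous f y -> continuity_2d_pt (fun _ b => f b) x y.
Proof.
  intros H; apply continuity_1d_2d_pt_comp.
  - now apply continuity_pt_filterlim.
  - apply continuity_2d_pt_id2.
Qed.

Lemma continuity_2d_pt_section (f : R -> R -> R) (x y : R) :
  continuity_2d_pt f x y -> continuous (f x) y.
Proof.
  rewrite continuity_2d_pt_filterlim; intros H.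
  apply (continuous_comp_2 (fun _ : R => x) (fun t : R => t) f y);
    [apply continuous_const | apply continuous_id | exact H].
Qed.

Lemma polar_in_disk (r t : R) :
  -1 < r < 1 -> (r * cos t) ^ 2 + (r * sin t) ^ 2 < 1.
Proof.
  intros H; generalize (sin2_cos2 t); unfold Rsqr; intros E.
  replace (_ + _) with (r ^ 2 * (sin t * sin t + cos t * cos t)) by ring.
  rewrite E; nra.
Qed.

Lemma continuity_2d_pt_polar (f : R -> R -> R) (r t : R) :
  continuity_2d_pt f (r * cos t) (r * sin t) ->
  continuity_2d_pt (fun r t => f (r * cos t) (r * sin t)) r t.
Proof.
  intros H.
  apply (continuity_2d_pt_comp f (fun r t => r * cos t) (fun r t => r * sin t));
    [exact H | |]; apply continuity_2d_pt_mult;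
    try apply continuity_2d_pt_id1; apply continuity_2d_pt_snd;
    auto using continuous_cos, continuous_sin.
Qed.

(* In polar coordinates the Cauchy-Riemann equations read
   [r u_r = v_t] and [r v_r = - u_t]. *)
Lemma cauchy_riemann_polar (u v ux uy : R -> R -> R) (r t : R) :
  cauchy_riemann u v ux uy -> -1 < r < 1 ->
  let ur := cos t * ux (r * cos t) (r * sin t)
            + sin t * uy (r * cos t) (r * sin t) in
  let vr := sin t * ux (r * cos t) (r * sin t)
            - cos t * uy (r * cos t) (r * sin t) in
  is_derive (fun r => u (r * cos t) (r * sin t)) r ur /\
  is_derive (fun r => v (r * cos t) (r * sin t)) r vr /\
  is_derive (fun t => u (r * cos t) (r * sin t)) t (- (r * vr)) /\
  is_derive (fun t => v (r * cos t) (r * sin t)) t (r * ur).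
Proof.
  intros CR Hr; cbv zeta.
  generalize (polar_in_disk r t Hr); intros HD.
  destruct (CR _ _ HD) as [H1 H2 H3 H4 H5 H6].
  assert (Du := C1_differentiable u ux uy _ _ HD
    (fun x y H => cr_dxu _ _ _ _ _ _ (CR x y H)) H2 H5).
  assert (Dv := C1_differentiable v (fun x y => - uy x y) ux _ _ HD
    (fun x y H => cr_dxv _ _ _ _ _ _ (CR x y H)) H4
    (continuity_2d_pt_opp _ _ _ H6)).
  assert (Cr : derivable_pt_lim (fun r => r * cos t) r (cos t))
    by (apply is_derive_Reals; auto_derive; [easy | ring]).
  assert (Sr : derivable_pt_lim (fun r => r * sin t) r (sin t))
    by (apply is_derive_Reals; auto_derive; [easy | ring]).
  assert (Ct : derivable_pt_lim (fun t => r * cos t) t (- (r * sin t)))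
    by (apply is_derive_Reals; auto_derive; [easy | ring]).
  assert (St : derivable_pt_lim (fun t => r * sin t) t (r * cos t))
    by (apply is_derive_Reals; auto_derive; [easy | ring]).
  assert (Eq : forall f x l l', derivable_pt_lim f x l -> l = l' ->
    is_derive f x l') by (intros f x l l' H <-; now apply is_derive_Reals).
  split; [| split; [| split]].
  - apply (Eq _ _ _ _ (derivable_pt_lim_comp_2d _ _ _ _ _ _ _ _ Du Cr Sr)).
    ring.
  - apply (Eq _ _ _ _ (derivable_pt_lim_comp_2d _ _ _ _ _ _ _ _ Dv Cr Sr)).
    ring.
  - apply (Eq _ _ _ _ (derivable_pt_lim_comp_2d _ _ _ _ _ _ _ _ Du Ct St)).
    ring.
  - apply (Eq _ _ _ _ (derivable_pt_lim_comp_2d _ _ _ _ _ _ _ _ Dv Ct St)).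
    ring.
Qed.

(** The real part of [conj(P + i Q) (u + i v)] at [r exp(i t)]: complex Fourier integrands written
    with real functions. *)
Definition polar (P Q : R -> R) (u v : R -> R -> R) (r t : R) : R :=
  P t * u (r * cos t) (r * sin t) + Q t * v (r * cos t) (r * sin t).

(** The radial derivative of [polar], with the partial derivatives of [v] eliminated by the
    Cauchy-Riemann equations. *)
Definition polar_dr (P Q : R -> R) (ux uy : R -> R -> R) (r t : R) : R :=
  P t * (cos t * ux (r * cos t) (r * sin t)
         + sin t * uy (r * cos t) (r * sin t))
  + Q t * (sin t * ux (r * cos t) (r * sin t)
           - cos t * uy (r * cos t) (r * sin t)).

Definition circle_integral (P Q : R -> R) (u v : R -> R -> R) (r : R) : R :=
  RInt (polar P Q u v r) 0 (2 * PI).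

Definition circle_integral_derivative (P Q : R -> R) (ux uy : R -> R -> R)
    (r : R) : R :=
  RInt (polar_dr P Q ux uy r) 0 (2 * PI).

Lemma is_derive_polar (P Q : R -> R) (u v ux uy : R -> R -> R) (r t : R) :
  cauchy_riemann u v ux uy -> -1 < r < 1 ->
  is_derive (fun r => polar P Q u v r t) r (polar_dr P Q ux uy r t).
Proof.
  intros CR Hr.
  destruct (cauchy_riemann_polar u v ux uy r t CR Hr) as (H1 & H2 & _ & _).
  apply (is_derive_plus (V := R_NormedModule)); now apply is_derive_scal.
Qed.

Lemma continuous_polar (P Q : R -> R) (u v ux uy : R -> R -> R) (r t : R) :
  cauchy_riemann u v ux uy -> continuous P t -> continuous Q t ->
  -1 < r < 1 -> continuous (polar P Q u v r) t.
Proof.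
  intros CR HP HQ Hr.
  destruct (cauchy_riemann_polar u v ux uy r t CR Hr) as (_ & _ & H3 & H4).
  apply (continuous_plus (V := R_NormedModule));
    apply (continuous_mult (K := R_AbsRing)); auto;
    eapply is_derive_continuous; eassumption.
Qed.

Lemma continuity_2d_pt_polar_dr (P Q : R -> R) (u v ux uy : R -> R -> R)
    (r t : R) :
  cauchy_riemann u v ux uy -> continuous P t -> continuous Q t ->
  -1 < r < 1 -> continuity_2d_pt (polar_dr P Q ux uy) r t.
Proof.
  intros CR HP HQ Hr.
  destruct (CR _ _ (polar_in_disk r t Hr)) as [_ _ _ _ H5 H6].
  apply continuity_2d_pt_polar in H5. apply continuity_2d_pt_polar in H6.
  assert (Cs : continuous cos t) by apply continuous_cos.
  assert (Sn : continuous sin t) by apply continuous_sin.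
  unfold polar_dr.
  repeat first [apply continuity_2d_pt_minus | apply continuity_2d_pt_plus
    | apply continuity_2d_pt_mult]; auto using continuity_2d_pt_snd.
Qed.

Lemma locally_between (a b r : R) : a < r < b -> locally r (fun s => a < s < b).
Proof.
  intros [H1 H2]; apply filter_and; [now apply open_gt | now apply open_lt].
Qed.

(** Differentiation under the integral sign. Negative radii are allowed so that [r = 0] is an
    interior point, where the initial data of the Euler equations are read off. *)
Lemma is_derive_circle_integral (P Q : R -> R) (u v ux uy : R -> R -> R)
    (r : R) :
  cauchy_riemann u v ux uy -> (forall t, continuous P t) ->
  (forall t, continuous Q t) -> -1 < r < 1 ->
  is_derive (circle_integral P Q u v) r
    (circle_integral_derivative P Q ux uy r).
Proof.
  intros CR HP HQ Hr.
  assert (HI := locally_between _ _ _ Hr).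
  assert (E : circle_integral_derivative P Q ux uy r =
    RInt (fun t => Derive (fun r => polar P Q u v r t) r) 0 (2 * PI)).
  { apply RInt_ext; intros t _; symmetry; apply is_derive_unique.
    now apply is_derive_polar. }
  rewrite E.
  apply (is_derive_RInt_param (polar P Q u v)).
  - revert HI; apply filter_imp; intros s Hs t _.
    eexists; now apply is_derive_polar with (ux := ux) (uy := uy).
  - intros t _.
    apply (continuity_2d_pt_ext_loc (polar_dr P Q ux uy)).
    + assert (L : locally (r, t) (fun p : R * R => -1 < fst p < 1))
        by exact (continuous_fst r t _ HI).
      apply locally_2d_locally; revert L; apply filter_imp.
      intros [s w]; simpl; intros Hs; symmetry; apply is_derive_unique.
      exact (is_derive_polar P Q u v ux uy s w CR Hs).
    + now apply (continuity_2d_pt_polar_dr P Q u v).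
  - revert HI; apply filter_imp; intros s Hs.
    apply (ex_RInt_continuous (V := R_CompleteNormedModule)); intros t _.
    now apply (continuous_polar P Q u v ux uy).
Qed.

(* [P + i Q = c exp (i k t)], so this is [r F'(r) = k F(r)] for
   [F(r) = Re (integral of conj(c) exp (- i k t) f(r exp (i t)))]. *)
Lemma circle_integral_euler (k : R) (P Q : R -> R) (u v ux uy : R -> R -> R)
    (r : R) :
  cauchy_riemann u v ux uy ->
  (forall t, is_derive P t (- k * Q t)) -> (forall t, is_derive Q t (k * P t)) ->
  P (2 * PI) = P 0 -> Q (2 * PI) = Q 0 -> -1 < r < 1 ->
  r * circle_integral_derivative P Q ux uy r = k * circle_integral P Q u v r.
Proof.
  intros CR HP HQ P0 Q0 Hr.
  assert (CP : forall t, continuous P t).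
  { intros t; exact (is_derive_continuous _ _ _ (HP t)). }
  assert (CQ : forall t, continuous Q t).
  { intros t; exact (is_derive_continuous _ _ _ (HQ t)). }
  set (e := polar P Q u v r).
  set (de := polar_dr P Q ux uy r).
  (* The imaginary part of [conj(P + i Q) (u + i v)]. By the polar Cauchy-Riemann equations its
     angular derivative is [r * de - k * e], whose integral vanishes because [g] is periodic. *)
  set (g := fun t => P t * v (r * cos t) (r * sin t)
                 - Q t * u (r * cos t) (r * sin t)).
  assert (Ce : forall t, continuous e t)
    by (intros t; now apply (continuous_polar P Q u v ux uy)).
  assert (Cde : forall t, continuous de t).
  { intros t; apply continuity_2d_pt_section.
    now apply (continuity_2d_pt_polar_dr P Q u v). }
  assert (Dg : forall t, is_derive g t (r * de t - k * e t)).
  { intros t.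
    destruct (cauchy_riemann_polar u v ux uy r t CR Hr) as (_ & _ & H3 & H4).
    apply is_derive_Reals in H3. apply is_derive_Reals in H4.
    assert (HP' := HP t). assert (HQ' := HQ t).
    apply is_derive_Reals in HP'. apply is_derive_Reals in HQ'.
    apply is_derive_Reals.
    replace (r * de t - k * e t) with
      ((- k * Q t * v (r * cos t) (r * sin t)
        + P t * (r * (cos t * ux (r * cos t) (r * sin t)
                      + sin t * uy (r * cos t) (r * sin t))))
       - (k * P t * u (r * cos t) (r * sin t)
          + Q t * - (r * (sin t * ux (r * cos t) (r * sin t)
                          - cos t * uy (r * cos t) (r * sin t)))))
      by (unfold de, e, polar, polar_dr; ring).
    exact (derivable_pt_lim_minus _ _ _ _ _
      (derivable_pt_lim_mult _ _ _ _ _ HP' H4)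
      (derivable_pt_lim_mult _ _ _ _ _ HQ' H3)). }
  assert (I := is_RInt_derive (V := R_CompleteNormedModule) g
    (fun t => r * de t - k * e t) 0 (2 * PI) (fun t _ => Dg t)
    (fun t _ => continuous_minus (V := R_NormedModule) _ _ _ 
       (continuous_scal_r (V := R_NormedModule) r de t (Cde t)) 
       (continuous_scal_r (V := R_NormedModule) k e t (Ce t)))).
  apply (is_RInt_unique (V := R_CompleteNormedModule)) in I.
  assert (Ie : ex_RInt e 0 (2 * PI)).
  { apply (ex_RInt_continuous (V := R_CompleteNormedModule)); auto. }
  assert (Ide : ex_RInt de 0 (2 * PI)).
  { apply (ex_RInt_continuous (V := R_CompleteNormedModule)); auto. }
  unfold circle_integral_derivative, circle_integral; fold e; fold de.
  assert (L : RInt (fun t => r * de t - k * e t) 0 (2 * PI)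
    = r * RInt de 0 (2 * PI) - k * RInt e 0 (2 * PI)).
  { apply (is_RInt_unique (V := R_CompleteNormedModule)).
    apply (is_RInt_minus (V := R_NormedModule));
      apply (is_RInt_scal (V := R_NormedModule));
      now apply (RInt_correct (V := R_CompleteNormedModule)). }
  rewrite L in I.
  change (r * RInt de 0 (2 * PI) - k * RInt e 0 (2 * PI) = g (2 * PI) - g 0)
    in I.
  assert (G : g (2 * PI) = g 0).
  { unfold g; rewrite P0, Q0, sin_2PI, cos_2PI, sin_0, cos_0; ring. }
  lra.
Qed.

(** * Euler equations [s E' = k E] for [k = 0, -1, 1] *)

Lemma euler_0 (E dE : R -> R) (r : R) :
  (forall s, -1 < s < 1 -> is_derive E s (dE s)) ->
  (forall s, -1 < s < 1 -> s * dE s = 0) -> 0 < r < 1 -> E r = E 0.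
Proof.
  intros HE Hs Hr.
  destruct (MVT_gen E 0 r (fun _ => 0)) as (c & _ & Hc).
  - rewrite Rmin_left, Rmax_right by lra; intros s H.
    replace 0 with (dE s); [apply HE; lra |].
    assert (Z := Hs s ltac:(lra)); apply Rmult_integral in Z; lra.
  - rewrite Rmin_left, Rmax_right by lra; intros s H.
    apply continuity_pt_filterlim, (is_derive_continuous E s (dE s)), HE; lra.
  - lra.
Qed.

(** The solutions [c / s] are singular at 0: [s * E s] has zero derivative and vanishes at 0. *)
Lemma euler_neg1 (E dE : R -> R) (r : R) :
  (forall s, -1 < s < 1 -> is_derive E s (dE s)) ->
  (forall s, -1 < s < 1 -> s * dE s = - E s) -> 0 < r < 1 -> E r = 0.
Proof.
  intros HE Hs Hr.
  assert (H : (fun s => s * E s) r = (fun s => s * E s) 0).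
  { apply (euler_0 (fun s => s * E s) (fun s => 1 * E s + s * dE s)); auto.
    - intros s H; apply is_derive_Reals.
      apply (derivable_pt_lim_mult (fun s => s) E).
      + apply derivable_pt_lim_id.
      + now apply is_derive_Reals, HE.
    - intros s H; rewrite (Hs s H); ring. }
  simpl in H; nra.
Qed.

(** The quotient [E s / s] is constant for [s > 0], and since [E 0 = 0] it tends to [dE 0] at the
    centre. *)
Lemma euler_1 (E dE : R -> R) (r : R) :
  (forall s, -1 < s < 1 -> is_derive E s (dE s)) ->
  (forall s, -1 < s < 1 -> s * dE s = E s) -> 0 < r < 1 -> E r = r * dE 0.
Proof.
  intros HE Hs Hr.
  assert (E0 : E 0 = 0) by (rewrite <- (Hs 0); lra).
  assert (HC : forall s, 0 < s <= r -> E s / s = E r / r).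
  { intros s [H0 [Hsr | ->]]; [| easy].
    destruct (MVT_gen (fun s => E s / s) s r (fun _ => 0)) as (c & _ & Hc).
    - rewrite Rmin_left, Rmax_right by lra; intros x H.
      assert (D : is_derive (fun s => E s / s) x ((dE x * x - E x * 1) / x ^ 2)).
      { apply (is_derive_div E (fun s => s)); [apply HE; lra | | lra].
        apply (is_derive_id (K := R_AbsRing)). }
      replace 0 with ((dE x * x - E x * 1) / x ^ 2); [exact D |].
      rewrite <- (Hs x ltac:(lra)); field; lra.
    - rewrite Rmin_left, Rmax_right by lra; intros x H.
      apply continuity_pt_div; [| apply continuity_pt_id | lra].
      apply continuity_pt_filterlim, (is_derive_continuous E x (dE x)), HE; lra.
    - lra. }
  assert (D0 := HE 0 ltac:(lra)); apply is_derive_Reals in D0.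
  assert (Lim : forall eps, 0 < eps -> Rabs (E r / r - dE 0) < eps).
  { intros eps Heps; destruct (D0 eps Heps) as [d Hd].
    set (s := Rmin (d / 2) r).
    assert (0 < s <= r /\ s < d).
    { destruct d as [d d0]; simpl in *; unfold s.
      generalize (Rmin_l (d / 2) r) (Rmin_r (d / 2) r).
      generalize (Rmin_glb_lt (d / 2) r 0); lra. }
    rewrite <- (HC s) by easy.
    generalize (Hd s ltac:(lra) ltac:(rewrite Rabs_pos_eq; lra)).
    now rewrite Rplus_0_l, E0, Rminus_0_r. }
  assert (Z : E r / r = dE 0).
  { destruct (Req_dec (E r / r) (dE 0)) as [| N]; [easy | exfalso].
    assert (P := Rabs_pos_lt (E r / r - dE 0) ltac:(lra)).
    generalize (Lim _ P); lra. }
  rewrite <- Z; field; lra.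
Qed.

(** * Mean value property, first Fourier coefficient and Harnack's inequality *)

Lemma mean_value (u v ux uy : R -> R -> R) (r : R) :
  cauchy_riemann u v ux uy -> 0 < r < 1 ->
  RInt (fun t => u (r * cos t) (r * sin t)) 0 (2 * PI) = 2 * PI * u 0 0.
Proof.
  intros CR Hr.
  assert (D : forall c k x : R, k = 0 -> is_derive (fun _ : R => c) x k).
  { intros c k x ->; apply is_derive_Reals, derivable_pt_lim_const. }
  set (P := fun _ : R => 1). set (Q := fun _ : R => 0).
  assert (H : circle_integral P Q u v r = circle_integral P Q u v 0).
  { apply (euler_0 (circle_integral P Q u v)
      (circle_integral_derivative P Q ux uy)); auto.
    - intros s Hs; apply is_derive_circle_integral; auto;
        intros t; apply continuous_const.
    - intros s Hs; rewrite (circle_integral_euler 0 P Q u v); auto; try ring;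
        intros t; apply D; unfold P, Q; ring. }
  transitivity (circle_integral P Q u v r).
  { apply RInt_ext; intros t _; unfold polar, P, Q; simpl; ring. }
  rewrite H; transitivity (RInt (fun _ => u 0 0) 0 (2 * PI)).
  - apply RInt_ext; intros t _; unfold polar, P, Q; rewrite !Rmult_0_l; simpl.
    ring.
  - rewrite RInt_const; unfold scal; simpl; unfold mult; simpl; ring.
Qed.

(** With [P + i Q = (a - i b) exp(i t)], the weights [P + i Q] and [P - i Q] are modes 1 and -1.
    Adding their circle integrals cancels [v] and leaves twice the wanted integral of [P * u]. The
    mode -1 contributes nothing, and the mode 1 is determined by its derivative at the centre. *)
Lemma first_fourier_coefficient (u v ux uy : R -> R -> R) (a b r : R) :
  cauchy_riemann u v ux uy -> 0 < r < 1 ->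
  RInt (fun t => (a * cos t + b * sin t) * u (r * cos t) (r * sin t)) 0 (2 * PI)
  = PI * r * (a * ux 0 0 + b * uy 0 0).
Proof.
  intros CR Hr.
  set (P := fun t => a * cos t + b * sin t).
  set (Q := fun t => a * sin t - b * cos t).
  set (Q' := fun t => - Q t).
  assert (DP : forall t, is_derive P t (- Q t))
    by (intros t; unfold P, Q; auto_derive; [easy | ring]).
  assert (DQ : forall t, is_derive Q t (P t))
    by (intros t; unfold P, Q; auto_derive; [easy | ring]).
  assert (DQ' : forall t, is_derive Q' t (- P t)).
  { intros t; apply (is_derive_opp (V := R_NormedModule)), DQ. }
  assert (P0 : P (2 * PI) = P 0)
    by (unfold P; now rewrite cos_2PI, sin_2PI, cos_0, sin_0).
  assert (Q0 : Q (2 * PI) = Q 0)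
    by (unfold Q; now rewrite cos_2PI, sin_2PI, cos_0, sin_0).
  assert (CP : forall t, continuous P t)
    by (intros t; apply (is_derive_continuous _ _ _ (DP t))).
  assert (CQ : forall t, continuous Q t)
    by (intros t; apply (is_derive_continuous _ _ _ (DQ t))).
  assert (CQ' : forall t, continuous Q' t)
    by (intros t; apply (is_derive_continuous _ _ _ (DQ' t))).
  assert (H1 : circle_integral P Q u v r
    = r * circle_integral_derivative P Q ux uy 0).
  { apply euler_1; auto.
    - intros s Hs; now apply is_derive_circle_integral.
    - intros s Hs; rewrite (circle_integral_euler 1 P Q u v); auto; try ring;
        intros t; [replace (- (1) * Q t) with (- Q t) by ring |
                   replace (1 * P t) with (P t) by ring]; auto. }
  assert (H2 : circle_integral P Q' u v r = 0).
  { apply (euler_neg1 _ (circle_integral_derivative P Q' ux uy)); auto.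
    - intros s Hs; now apply is_derive_circle_integral.
    - intros s Hs; rewrite (circle_integral_euler (-1) P Q' u v); auto.
      + ring.
      + intros t; unfold Q'.
        replace (- -1 * - Q t) with (- Q t) by ring; auto.
      + intros t; replace (-1 * P t) with (- P t) by ring; auto.
      + unfold Q'; now rewrite Q0. }
  assert (H3 : circle_integral_derivative P Q ux uy 0
    = 2 * PI * (a * ux 0 0 + b * uy 0 0)).
  { unfold circle_integral_derivative.
    rewrite (RInt_ext _ (fun _ => a * ux 0 0 + b * uy 0 0)).
    - rewrite RInt_const; unfold scal; simpl; unfold mult; simpl; ring.
    - intros t _; unfold polar_dr, P, Q; rewrite !Rmult_0_l.
      generalize (sin2_cos2 t); unfold Rsqr; intros E.
      replace (a * ux 0 0 + b * uy 0 0) with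
        ((a * ux 0 0 + b * uy 0 0) * (sin t * sin t + cos t * cos t))
        by (rewrite E; ring).
      simpl; ring. }
  assert (EX : forall S, (forall t, continuous S t) ->
    ex_RInt (polar P S u v r) 0 (2 * PI)).
  { intros S CS; apply (ex_RInt_continuous (V := R_CompleteNormedModule)).
    intros t _; apply (continuous_polar P S u v ux uy); auto; lra. }
  assert (H4 : circle_integral P Q u v r + circle_integral P Q' u v r
    = RInt (fun t => 2 * ((a * cos t + b * sin t)
                          * u (r * cos t) (r * sin t))) 0 (2 * PI)).
  { symmetry; apply (is_RInt_unique (V := R_CompleteNormedModule)).
    apply (is_RInt_ext (fun t => plus (polar P Q u v r t) (polar P Q' u v r t))).
    - intros t _; unfold polar, Q', P, plus; simpl; ring.
    - apply (is_RInt_plus (V := R_NormedModule));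
        apply (RInt_correct (V := R_CompleteNormedModule)); auto. }
  assert (EX' : ex_RInt (fun t => (a * cos t + b * sin t)
                          * u (r * cos t) (r * sin t)) 0 (2 * PI)).
  { apply (ex_RInt_ext (polar P (fun _ => 0) u v r)).
    - intros t _; unfold polar, P; simpl; ring.
    - apply EX; intros t; apply continuous_const. }
  rewrite (RInt_scal (V := R_CompleteNormedModule)) in H4 by exact EX'.
  unfold scal in H4; simpl in H4; unfold mult in H4; simpl in H4.
  rewrite H1, H2, H3 in H4; unfold P; lra.
Qed.

(* A nonnegative weight [1 + a cos + b sin] against [M - u]: Harnack's
   inequality at the centre. *)
Lemma harnack_gradient (u v ux uy : R -> R -> R) (a b M : R) :
  cauchy_riemann u v ux uy -> a ^ 2 + b ^ 2 = 1 ->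
  (forall x y, x ^ 2 + y ^ 2 < 1 -> u x y <= M) ->
  a * ux 0 0 + b * uy 0 0 <= 2 * (M - u 0 0).
Proof.
  intros CR Hab HM.
  assert (Hr : forall r, 0 < r < 1 ->
    r * (a * ux 0 0 + b * uy 0 0) <= 2 * (M - u 0 0)).
  { intros r Hr.
    assert (C : forall t, continuous (fun t => u (r * cos t) (r * sin t)) t).
    { intros t.
      destruct (cauchy_riemann_polar u v ux uy r t CR ltac:(lra))
        as (_ & _ & H & _).
      eapply is_derive_continuous; exact H. }
    assert (Cp : forall t, continuous (fun t => a * cos t + b * sin t) t).
    { intros t; apply (is_derive_continuous _ t (a * - sin t + b * cos t)).
      auto_derive; [easy | ring]. }
    assert (E1 : ex_RInt (fun t => u (r * cos t) (r * sin t)) 0 (2 * PI)).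
    { apply (ex_RInt_continuous (V := R_CompleteNormedModule)); auto. }
    assert (E2 : ex_RInt (fun t => (a * cos t + b * sin t)
                          * u (r * cos t) (r * sin t)) 0 (2 * PI)).
    { apply (ex_RInt_continuous (V := R_CompleteNormedModule)); intros t _.
      now apply (continuous_mult (K := R_AbsRing)). }
    assert (I := is_RInt_plus (V := R_NormedModule) _ _ _ _ _ _
      (RInt_correct (V := R_CompleteNormedModule) _ _ _ E1)
      (RInt_correct (V := R_CompleteNormedModule) _ _ _ E2)).
    rewrite (mean_value u v ux uy), (first_fourier_coefficient u v ux uy) in I
      by easy.
    assert (J : is_RInt (fun t => M * (1 + (a * cos t + b * sin t))) 0 (2 * PI)
      (2 * PI * M)).
    { set (g := fun t => M * (t + (a * sin t - b * cos t))).
      replace (2 * PI * M) with (minus (g (2 * PI)) (g 0)).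
      - apply (is_RInt_derive (V := R_CompleteNormedModule)); intros t _.
        + unfold g; auto_derive; [easy | ring].
        + apply (continuous_scal_r (V := R_NormedModule) M).
          apply (continuous_plus (V := R_NormedModule)); auto.
          apply continuous_const.
      - unfold g, minus, plus, opp; simpl.
        rewrite cos_2PI, sin_2PI, cos_0, sin_0; ring. }
    assert (LE := is_RInt_le _ _ 0 (2 * PI) _ _
      ltac:(generalize PI_RGT_0; lra) I J).
    assert (Q : 2 * PI * u 0 0 + PI * r * (a * ux 0 0 + b * uy 0 0)
      <= 2 * PI * M).
    { apply LE; intros t _; unfold plus; simpl.
      (* Twice the weight is [(a + cos t)^2 + (b + sin t)^2], because [(a, b)] is a unit vector. *)
      assert (W : 0 <= 1 + (a * cos t + b * sin t)).
      { generalize (sin2_cos2 t); unfold Rsqr; intros E.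
        generalize (pow2_ge_0 (a + cos t)) (pow2_ge_0 (b + sin t)); nra. }
      assert (U := HM _ _ (polar_in_disk r t ltac:(lra))).
      nra. }
    generalize PI_RGT_0; nra. }
  set (G := a * ux 0 0 + b * uy 0 0) in *.
  destruct (Rle_lt_dec G (2 * (M - u 0 0))) as [| N]; [easy | exfalso].
  assert (M0 := HM 0 0 ltac:(lra)).
  set (K := 2 * (M - u 0 0)) in *.
  assert (0 <= K) by (unfold K; lra).
  (* This replaces the limit [r -> 1]: if [K < G], this radius makes [r * G] the midpoint of [K] and
     [G], which exceeds [K]. *)
  set (r := (K + G) / (2 * G)).
  assert (R1 : r * G = (K + G) / 2) by (unfold r; field; lra).
  assert (0 < r < 1) by (split; nra).
  generalize (Hr r ltac:(easy)); lra.
Qed.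

(** * Balls in convex sets *)

Definition Hdot (p q : quaternion) : R :=
  let '(a, b, c, d) := p in
  let '(a', b', c', d') := q in
  a * a' + b * b' + c * c' + d * d'.

Definition Hcoord (i : nat) (p : quaternion) : R :=
  let '(a, b, c, d) := p in
  match i with 0%nat => a | 1%nat => b | 2%nat => c | _ => d end.

Ltac Hdestruct := repeat match goal with
  | p : quaternion |- _ => destruct p as [[[? ?] ?] ?] end.

Ltac Hring := Hdestruct; simpl; repeat apply (f_equal2 pair); ring.

Lemma Hmod_dot (p : quaternion) : Hmod p = sqrt (Hdot p p).
Proof. Hdestruct; simpl; f_equal; ring. Qed.

Lemma Hdot_pos (p : quaternion) : 0 <= Hdot p p.
Proof. Hdestruct; simpl; nra. Qed.

Lemma Hmod_sqr (p : quaternion) : Hmod p ^ 2 = Hdot p p.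
Proof. rewrite Hmod_dot; apply pow2_sqrt, Hdot_pos. Qed.

Lemma Hmod_pos (p : quaternion) : 0 <= Hmod p.
Proof. rewrite Hmod_dot; apply sqrt_pos. Qed.

Lemma Hmod_triangle (p q : quaternion) : Hmod (p + q)%H <= Hmod p + Hmod q.
Proof.
  rewrite !Hmod_norm.
  replace (p + q)%H with (plus p q) by (Hdestruct; reflexivity).
  exact (norm_triangle p q).
Qed.

Lemma Hcoord_le (i : nat) (p : quaternion) : Rabs (Hcoord i p) <= Hmod p.
Proof.
  apply Rsqr_incr_0_var; [| apply Hmod_pos].
  rewrite <- Rsqr_abs, !Rsqr_pow2, Hmod_sqr.
  Hdestruct; destruct i as [| [| [| i]]]; simpl; nra.
Qed.

Lemma Hdot_unit_le (n p : quaternion) : Hdot n n = 1 -> Hdot n p <= Hmod p.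
Proof.
  intros Hn; destruct (Rle_lt_dec (Hdot n p) 0) as [| P].
  { generalize (Hmod_pos p); lra. }
  apply Rsqr_incr_0_var; [| apply Hmod_pos].
  rewrite !Rsqr_pow2, Hmod_sqr.
  assert (E := Hdot_pos (RtoH (Hdot n p) * n - p)%H).
  replace (Hdot (RtoH (Hdot n p) * n - p)%H (RtoH (Hdot n p) * n - p)%H)
    with (Hdot n p ^ 2 * Hdot n n - 2 * Hdot n p ^ 2 + Hdot p p) in E
    by (Hdestruct; simpl; ring).
  rewrite Hn in E; lra.
Qed.

Definition affine (c : quaternion -> R) : Prop :=
  forall p q t,
    c (RtoH (1 - t) * p + RtoH t * q)%H = (1 - t) * c p + t * c q.

Lemma affine_Hcoord (i : nat) : affine (Hcoord i).
Proof.
  intros p q t; Hdestruct; destruct i as [| [| [| i]]]; simpl; ring.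
Qed.

Lemma convex_and (A B : quaternion -> Prop) :
  convex A -> convex B -> convex (fun k => A k /\ B k).
Proof. intros HA HB p q t [] [] Ht; split; auto. Qed.

(** The boolean makes an open orthant around a point a function [nat -> bool]. *)
Definition side (s : bool) (x y : R) : Prop := if s then x < y else y < x.

Lemma convex_side (c : quaternion -> R) (s : bool) (x : R) :
  affine c -> convex (fun k => side s (c k) x).
Proof.
  intros Hc p q t Hp Hq Ht; rewrite Hc; destruct s; simpl in *.
  - replace x with ((1 - t) * x + t * x) by ring.
    destruct (Rle_lt_dec t (1 / 2)); nra.
  - replace x with ((1 - t) * x + t * x) by ring.
    destruct (Rle_lt_dec t (1 / 2)); nra.
Qed.

Lemma convex_level (c : quaternion -> R) (x : R) :
  affine c -> convex (fun k => c k = x).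
Proof. intros Hc p q t Hp Hq Ht; rewrite Hc, Hp, Hq; ring. Qed.

Lemma convex_cross_level (K : quaternion -> Prop) (c : quaternion -> R) (x : R) :
  convex K -> affine c -> (forall s, exists k, K k /\ side s (c k) x) ->
  exists k, K k /\ c k = x.
Proof.
  intros HK Hc H.
  destruct (H true) as (p & Kp & Hp); destruct (H false) as (q & Kq & Hq).
  simpl in Hp, Hq.
  set (t := (x - c p) / (c q - c p)).
  assert (E : t * (c q - c p) = x - c p) by (unfold t; field; lra).
  assert (0 <= t <= 1) by (split; nra).
  exists (RtoH (1 - t) * p + RtoH t * q)%H; split.
  - now apply HK.
  - rewrite Hc; lra.
Qed.

(** Coordinates are fixed one at a time. Two points of [K] in orthants that differ only in the sign
    of one coordinate are joined by a segment crossing the level of [w] in that coordinate, while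
    the other constraints, being convex, persist. The 16 orthants thus reduce to 8, 4, 2 and finally
    1 point, which is [w]. *)
Lemma convex_orthants (K : quaternion -> Prop) (w : quaternion) :
  convex K ->
  (forall s : nat -> bool, exists k, K k /\
     forall i, (i <= 3)%nat -> side (s i) (Hcoord i k) (Hcoord i w)) ->
  K w.
Proof.
  intros HK H.
  assert (A := affine_Hcoord).
  assert (H1 : forall s1 s2 s3, exists k,
    (K k /\ side s1 (Hcoord 1 k) (Hcoord 1 w) /\
     side s2 (Hcoord 2 k) (Hcoord 2 w) /\ side s3 (Hcoord 3 k) (Hcoord 3 w)) /\
    Hcoord 0 k = Hcoord 0 w).
  { intros s1 s2 s3; apply convex_cross_level; auto.
    - auto 10 using convex_and, convex_side.
    - intros s0; destruct (H (fun i => match i with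
        0%nat => s0 | 1%nat => s1 | 2%nat => s2 | _ => s3 end)) as (k & Kk & Hk).
      exists k; generalize (Hk 0%nat ltac:(lia)) (Hk 1%nat ltac:(lia))
        (Hk 2%nat ltac:(lia)) (Hk 3%nat ltac:(lia)); tauto. }
  assert (H2 : forall s2 s3, exists k,
    ((K k /\ Hcoord 0 k = Hcoord 0 w) /\
     side s2 (Hcoord 2 k) (Hcoord 2 w) /\ side s3 (Hcoord 3 k) (Hcoord 3 w)) /\
    Hcoord 1 k = Hcoord 1 w).
  { intros s2 s3; apply convex_cross_level; auto.
    - auto 10 using convex_and, convex_side, convex_level.
    - intros s1; destruct (H1 s1 s2 s3) as (k & Hk); exists k; tauto. }
  assert (H3 : forall s3, exists k,
    ((K k /\ Hcoord 0 k = Hcoord 0 w /\ Hcoord 1 k = Hcoord 1 w) /\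
     side s3 (Hcoord 3 k) (Hcoord 3 w)) /\ Hcoord 2 k = Hcoord 2 w).
  { intros s3; apply convex_cross_level; auto.
    - auto 10 using convex_and, convex_side, convex_level.
    - intros s2; destruct (H2 s2 s3) as (k & Hk); exists k; tauto. }
  destruct (convex_cross_level (fun k => K k /\ Hcoord 0 k = Hcoord 0 w /\
    Hcoord 1 k = Hcoord 1 w /\ Hcoord 2 k = Hcoord 2 w) (Hcoord 3) (Hcoord 3 w))
    as (k & (Kk & E0 & E1 & E2) & E3); auto.
  - auto 10 using convex_and, convex_level.
  - intros s3; destruct (H3 s3) as (k & Hk); exists k; tauto.
  - replace w with k; [easy |].
    Hdestruct; simpl in *; congruence.
Qed.

(** Around [w] there is room to approximate a point inside each of the 16 orthants, so
    [convex_orthants] applies. *)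
Lemma convex_dense_ball (K : quaternion -> Prop) (c w : quaternion) (r : R) :
  convex K ->
  (forall z, Hmod (z - c)%H < r ->
     forall eps, 0 < eps -> exists k, K k /\ Hmod (k - z)%H < eps) ->
  Hmod (w - c)%H < r -> K w.
Proof.
  intros HK HD Hw; apply convex_orthants; [easy |]; intros s.
  assert (He : exists e, 0 < e /\ Hmod (w - c)%H + 2 * e < r).
  { exists ((r - Hmod (w - c)%H) / 3); lra. }
  destruct He as (e & He & Her).
  (* The displacement with all coordinates [e] or [- e] has modulus [2 * e], so it stays in the
     ball; an error below [e] cannot change the sign of any coordinate. *)
  set (sg := fun i : nat => if s i then - e else e).
  set (z := (sg 0%nat, sg 1%nat, sg 2%nat, sg 3%nat) : quaternion).
  assert (Hz : Hmod z = 2 * e).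
  { rewrite Hmod_dot; unfold z; simpl.
    rewrite <- (sqrt_pow2 (2 * e)) by lra; f_equal.
    unfold sg; destruct (s 0%nat), (s 1%nat), (s 2%nat), (s 3%nat); ring. }
  destruct (HD (w + z)%H) with (eps := e) as (k & Kk & Hk); [| easy |].
  { replace (w + z - c)%H with ((w - c) + z)%H
      by (clearbody z; Hring).
    generalize (Hmod_triangle (w - c)%H z); lra. }
  exists k; split; [easy |]; intros i Hi.
  assert (B := Rle_lt_trans _ _ _ (Hcoord_le i _) Hk).
  apply Rabs_def2 in B.
  unfold z in B; clear Hz z Hw Hk; Hdestruct.
  destruct i as [| [| [| [| i]]]]; [| | | | lia]; simpl in *; unfold sg in B;
    match goal with |- side (s ?i) _ _ => destruct (s i) end; simpl in *; lra.
Qed.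

(** Here [p] is the projection of [w] on the closure of [K], obtained as the limit of a minimizing
    sequence, and it may lie outside [K]. Hence minimality is expressed through lower bounds of the
    squared distances to points of [K]. *)
Lemma convex_nearest (K : quaternion -> Prop) (w : quaternion) :
  convex K -> (exists k, K k) ->
  exists p, (forall k, K k -> 0 <= Hdot (p - w)%H (k - p)%H) /\
    (forall d, (forall k, K k -> d <= Hdot (k - w)%H (k - w)%H) ->
      d <= Hdot (p - w)%H (p - w)%H).
Proof.
  intros HK [k0 Hk0].
  set (S := fun k => Hdot (k - w)%H (k - w)%H).
  (* The infimum [m] of the squared distances is minus the supremum of their opposites. *)
  destruct (completeness (fun r => exists k, K k /\ r = - S k)) as [M [HM1 HM2]].
  { exists 0; intros r (k & _ & ->); generalize (Hdot_pos (k - w)%H).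
    unfold S; lra. }
  { exists (- S k0); now exists k0. }
  set (m := - M).
  assert (Hm : forall k, K k -> m <= S k).
  { intros k Kk; assert (- S k <= M) by (apply HM1; now exists k).
    unfold m; lra. }
  assert (Hseq : forall n : nat, exists k, K k /\ S k < m + / INR (n + 1)).
  { intros n; apply NNPP; intros N.
    assert (P : 0 < / INR (n + 1)) by (apply Rinv_0_lt_compat, lt_0_INR; lia).
    assert (M <= M - / INR (n + 1)); [| lra].
    apply HM2; intros r (k & Kk & ->).
    destruct (Rle_lt_dec (m + / INR (n + 1)) (S k)); [unfold m in *; lra |].
    exfalso; apply N; now exists k. }
  apply functional_choice in Hseq; destruct Hseq as [k Hk].
  (* Parallelogram law: a minimizing sequence is Cauchy. *)
  assert (Hpq : forall p q, Hdot (k p - k q)%H (k p - k q)%H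
    <= 2 * (/ INR (p + 1) + / INR (q + 1))).
  { intros p q; destruct (Hk p) as [Kp Sp]; destruct (Hk q) as [Kq Sq].
    assert (Mid := Hm _ (HK _ _ (1 / 2) Kp Kq ltac:(lra))).
    unfold S in *; revert Sp Sq Mid.
    generalize (k p) (k q); intros a b; Hdestruct; simpl; nra. }
  assert (Hinv : is_lim_seq (fun n => / INR (n + 1)) 0).
  { apply (is_lim_seq_incr_n (fun n => / INR n) 1).
    replace (Finite 0) with (Rbar_inv p_infty) by easy.
    apply is_lim_seq_inv; [apply is_lim_seq_INR | easy]. }
  assert (Hlim : forall i, exists l : R, is_lim_seq (fun n => Hcoord i (k n)) l).
  { intros i; apply ex_lim_seq_cauchy_corr; intros eps.
    assert (E2 : 0 < eps ^ 2 / 8) by (destruct eps as [e He]; simpl; nra).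
    apply is_lim_seq_spec in Hinv.
    destruct (Hinv (mkposreal _ E2)) as [N HN]; exists N; intros p q Hp Hq.
    assert (Np := HN p Hp); assert (Nq := HN q Hq); simpl in Np, Nq.
    rewrite Rminus_0_r in Np, Nq.
    apply Rabs_def2 in Np; apply Rabs_def2 in Nq.
    assert (C := Hcoord_le i (k p - k q)%H).
    replace (Hcoord i (k p - k q)%H) with (Hcoord i (k p) - Hcoord i (k q)) in C
      by (generalize (k p) (k q); intros a b; Hdestruct;
          destruct i as [| [| [| i]]]; simpl; ring).
    apply (Rle_lt_trans _ _ _ C), Rsqr_incrst_0.
    - rewrite !Rsqr_pow2, Hmod_sqr; generalize (Hpq p q) (cond_pos eps); nra.
    - apply Hmod_pos.
    - left; apply cond_pos. }
  destruct (Hlim 0%nat) as [a La]; destruct (Hlim 1%nat) as [b Lb].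
  destruct (Hlim 2%nat) as [c Lc]; destruct (Hlim 3%nat) as [d Ld].
  assert (Ldot : forall x y, is_lim_seq (fun n => Hdot (k n - x)%H (k n - y)%H)
    (Hdot ((a, b, c, d) - x)%H ((a, b, c, d) - y)%H)).
  { intros x y.
    apply (is_lim_seq_ext (fun n =>
      (Hcoord 0 (k n) - Hcoord 0 x) * (Hcoord 0 (k n) - Hcoord 0 y)
      + (Hcoord 1 (k n) - Hcoord 1 x) * (Hcoord 1 (k n) - Hcoord 1 y)
      + (Hcoord 2 (k n) - Hcoord 2 x) * (Hcoord 2 (k n) - Hcoord 2 y)
      + (Hcoord 3 (k n) - Hcoord 3 x) * (Hcoord 3 (k n) - Hcoord 3 y))).
    { intros n; generalize (k n); intros z; Hdestruct; simpl; ring. }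
    replace (Hdot ((a, b, c, d) - x)%H ((a, b, c, d) - y)%H) with
      ((a - Hcoord 0 x) * (a - Hcoord 0 y)
      + (b - Hcoord 1 x) * (b - Hcoord 1 y)
      + (c - Hcoord 2 x) * (c - Hcoord 2 y)
      + (d - Hcoord 3 x) * (d - Hcoord 3 y)) by (Hdestruct; simpl; ring).
    repeat first [apply is_lim_seq_minus' | apply is_lim_seq_plus'
      | apply is_lim_seq_mult']; auto using is_lim_seq_const. }
  exists (a, b, c, d); split.
  - intros z Kz.
    set (A := Hdot ((a, b, c, d) - w)%H (z - (a, b, c, d))%H).
    set (B := Hdot ((a, b, c, d) - z)%H ((a, b, c, d) - z)%H).
    assert (HB : 0 <= B) by apply Hdot_pos.
    (* Moving from [k n] towards [z] by the fraction [t] stays in [K], so the squared distance to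
       [w] remains at least [m]; at [k n] it was below [m + / INR (n + 1)]. Let [n] tend to
       infinity. *)
    assert (Ht : forall t, 0 <= t <= 1 -> 0 <= 2 * t * A + t ^ 2 * B).
    { intros t Ht.
      apply (is_lim_seq_le (fun _ => 0) (fun n =>
        / INR (n + 1) - 2 * t * Hdot (k n - w)%H (k n - z)%H
        + t ^ 2 * Hdot (k n - z)%H (k n - z)%H) 0 (2 * t * A + t ^ 2 * B)).
      - intros n; destruct (Hk n) as [Kn Sn].
        assert (Mt := Hm _ (HK _ _ t Kn Kz Ht)).
        unfold S in *; revert Mt Sn; generalize (k n); intros y.
        clear; Hdestruct; simpl; intros; lra.
      - apply is_lim_seq_const.
      - replace (2 * t * A + t ^ 2 * B) with
          (0 - 2 * t * Hdot ((a, b, c, d) - w)%H ((a, b, c, d) - z)%H + t ^ 2 * B)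
          by (unfold A; Hdestruct; simpl; ring).
        apply is_lim_seq_plus'; [apply is_lim_seq_minus' |];
          [easy | |]; apply is_lim_seq_mult'; auto using is_lim_seq_const;
          apply Ldot. }
    destruct (Rle_lt_dec 0 A) as [| NA]; [easy | exfalso].
    (* If [A < 0], then [t * B < - A], so the quadratic is below [t * A < 0]. The denominator
       [B + 1] stays positive when [B = 0]. *)
    set (t := Rmin 1 (- A / (B + 1))).
    assert (T : 0 < t <= 1 /\ t * (B + 1) <= - A).
    { assert (P : 0 < - A / (B + 1)) by (apply Rdiv_lt_0_compat; lra).
      assert (L1 := Rmin_l 1 (- A / (B + 1))).
      assert (L2 := Rmin_r 1 (- A / (B + 1))); fold t in L1, L2.
      split; [split; [apply Rmin_glb_lt; lra | easy] |].
      replace (- A) with (- A / (B + 1) * (B + 1)) by (field; lra).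
      apply Rmult_le_compat_r; lra. }
    generalize (Ht t ltac:(lra)); nra.
  - intros e He.
    apply (is_lim_seq_le (fun _ => e) (fun n => S (k n)) e
      (Hdot ((a, b, c, d) - w)%H ((a, b, c, d) - w)%H)); [| | apply Ldot].
    + intros n; apply He, Hk.
    + apply is_lim_seq_const.
Qed.

(** By [convex_dense_ball] only density has to be shown. A point [w] of the ball at positive
    distance from [K] is separated from it by a half-space that leaves less than [r] of room at
    [c]. *)
Lemma convex_ball_of_support (K : quaternion -> Prop) (c w : quaternion) (r : R) :
  convex K -> (exists k, K k) ->
  (forall n M, Hdot n n = 1 -> (forall k, K k -> Hdot n k <= M) ->
     r <= M - Hdot n c) ->
  Hmod (w - c)%H < r -> K w.
Proof.
  intros HK Hne HS Hw; apply (convex_dense_ball K c w r HK); [| easy].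
  clear w Hw; intros w Hw eps Heps; apply NNPP; intros Far.
  destruct (convex_nearest K w HK Hne) as (p & Hp & Hd).
  set (L := Hmod (p - w)%H).
  assert (HL : 0 < L).
  { assert (L0 : 0 <= L) by apply Hmod_pos.
    assert (eps ^ 2 <= L ^ 2); [| nra].
    unfold L; rewrite Hmod_sqr; apply Hd; intros k Kk; rewrite <- Hmod_sqr.
    destruct (Rle_lt_dec eps (Hmod (k - w)%H)) as [| N]; [nra |].
    exfalso; apply Far; now exists k. }
  assert (L2 := Hmod_sqr (p - w)%H); fold L in L2.
  set (n := (RtoH (/ L) * (w - p))%H).
  assert (Dn : forall q, Hdot n q = - (/ L) * Hdot (p - w)%H q).
  { intros q; unfold n; clearbody L; Hdestruct; simpl; ring. }
  assert (Hn : Hdot n n = 1).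
  { replace (Hdot n n) with ((/ L) ^ 2 * L ^ 2); [field; lra |].
    rewrite L2; unfold n; clearbody L; Hdestruct; simpl; ring. }
  assert (IL : 0 < / L) by now apply Rinv_0_lt_compat.
  (* The bounding hyperplane is taken through [w], beyond the projection [p]. The room it leaves at
     [c] is at most [Hmod (w - c)], hence less than [r]. *)
  assert (HM : r <= Hdot n w - Hdot n c).
  { apply HS; [easy |]; intros k Kk; rewrite !Dn.
    replace (Hdot (p - w)%H k) with (Hdot (p - w)%H w + Hdot (p - w)%H (k - p)%H
      + Hdot (p - w)%H (p - w)%H) by (clear; Hdestruct; simpl; ring).
    generalize (Hp k Kk) (Hdot_pos (p - w)%H); nra. }
  generalize (Hdot_unit_le n (w - c)%H Hn).
  replace (Hdot n (w - c)%H) with (Hdot n w - Hdot n c); [lra |].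
  clearbody n; clear; Hdestruct; simpl; ring.
Qed.

(** * The lower bound *)

Lemma imaginary_unit_spec (I : quaternion) :
  imaginary_unit I <-> Hcoord 0 I = 0 /\ Hdot I I = 1.
Proof.
  destruct I as [[[a b] c] d]; unfold imaginary_unit, RtoH; simpl; split.
  - intros H; injection H; intros H3 H2 H1 H0.
    assert (a = 0) by nra; split; nra.
  - intros [-> H]; repeat apply (f_equal2 pair); nra.
Qed.

Lemma slice_point_coords (b c d x y : R) :
  slice_point (0, b, c, d) x y = (x, y * b, y * c, y * d).
Proof. unfold slice_point, RtoH; simpl; repeat apply (f_equal2 pair); ring. Qed.

Ltac destruct_unit I H :=
  apply imaginary_unit_spec in H;
  let a := fresh "a" in let b := fresh "b" in
  let c := fresh "c" in let d := fresh "d" in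
  let H0 := fresh "H0" in
  destruct I as [[[a b] c] d]; destruct H as [H0 H]; simpl in H0, H; subst a.

Lemma Hmod_slice_point (I : quaternion) (x y : R) :
  imaginary_unit I -> Hmod (slice_point I x y) = sqrt (x ^ 2 + y ^ 2).
Proof.
  intros H; destruct_unit I H; rewrite slice_point_coords; simpl; f_equal.
  replace (_ + _) with (x ^ 2 + y ^ 2 * (0 * 0 + b * b + c * c + d * d)) by ring.
  rewrite H; ring.
Qed.

Lemma unit_ball_slice_point (I : quaternion) (x y : R) :
  imaginary_unit I ->
  unit_ball (slice_point I x y) <-> x ^ 2 + y ^ 2 < 1.
Proof.
  intros H; unfold unit_ball; rewrite Hmod_slice_point by easy.
  rewrite <- sqrt_1 at 1; split; intros L.
  - now apply sqrt_lt_0_alt.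
  - apply sqrt_lt_1_alt; nra.
Qed.

(** The sign condition on [y] makes adding a positive multiple of [I] move away from the real axis.
    A real [q] lies on every slice, and [i] is chosen for it. *)
Lemma slice_point_exists (q : quaternion) :
  exists I x y, imaginary_unit I /\ 0 <= y /\ q = slice_point I x y.
Proof.
  destruct q as [[[a b] c] d].
  set (y := sqrt (b * b + c * c + d * d)).
  assert (Y2 : y * y = b * b + c * c + d * d) by (apply sqrt_sqrt; nra).
  assert (Y0 : 0 <= y) by apply sqrt_pos.
  destruct Y0 as [Y0 | Y0].
  - exists (0, b / y, c / y, d / y), a, y; split; [| split; [lra |]].
    + apply imaginary_unit_spec; simpl; split; [easy |].
      replace (_ + _) with ((b * b + c * c + d * d) / (y * y)) by (field; lra).
      rewrite <- Y2; field; lra.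
    + rewrite slice_point_coords; repeat apply (f_equal2 pair); field; lra.
  - exists (0, 1, 0, 0), a, 0; split; [| split; [lra |]].
    + apply imaginary_unit_spec; simpl; lra.
    + rewrite slice_point_coords, <- Y0 in *; repeat apply (f_equal2 pair); nra.
Qed.

Lemma slice_point_0 (I : quaternion) : slice_point I 0 0 = RtoH 0.
Proof. unfold slice_point, RtoH; Hring. Qed.

(** * Derivatives of quaternion-valued functions through real linear functionals *)

Lemma Hplus_plus (p q : quaternion) : plus p q = (p + q)%H.
Proof. Hdestruct; reflexivity. Qed.

Lemma Hmult_scal (x : R) (p : quaternion) : scal x p = (RtoH x * p)%H.
Proof.
  Hdestruct; simpl; unfold scal; simpl; unfold prod_scal; simpl.
  unfold scal; simpl; unfold prod_scal; simpl.
  unfold scal; simpl; unfold prod_scal; simpl.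
  unfold scal; simpl; unfold mult; simpl; Hring.
Qed.

Lemma Hdot_plus (m p q : quaternion) : Hdot m (p + q)%H = Hdot m p + Hdot m q.
Proof. Hring. Qed.

Lemma Hdot_scal (m : quaternion) (x : R) (p : quaternion) :
  Hdot m (RtoH x * p)%H = x * Hdot m p.
Proof. Hring. Qed.

Lemma is_linear_Hdot (m : quaternion) : is_linear (Hdot m).
Proof.
  split.
  - intros p q; rewrite Hplus_plus; apply Hdot_plus.
  - intros x p; rewrite Hmult_scal; apply Hdot_scal.
  - destruct m as [[[a b] c] d].
    set (M := Rabs a + Rabs b + Rabs c + Rabs d + 1).
    generalize (Rabs_pos a) (Rabs_pos b) (Rabs_pos c) (Rabs_pos d); intros.
    exists M; split; [unfold M; lra |]; intros p.
    rewrite <- Hmod_norm.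
    change (Rabs (Hdot (a, b, c, d) p) <= M * Hmod p).
    generalize (Hcoord_le 0 p) (Hcoord_le 1 p) (Hcoord_le 2 p) (Hcoord_le 3 p).
    generalize (Hmod_pos p); generalize (Hmod p); intros m Hm.
    destruct p as [[[a' b'] c'] d']; simpl; intros.
    assert (T : Rabs (a * a' + b * b' + c * c' + d * d') <=
      Rabs a * Rabs a' + Rabs b * Rabs b' + Rabs c * Rabs c' + Rabs d * Rabs d').
    { rewrite <- !Rabs_mult.
      eapply Rle_trans; [apply Rabs_triang |]; apply Rplus_le_compat_r.
      eapply Rle_trans; [apply Rabs_triang |]; apply Rplus_le_compat_r.
      apply Rabs_triang. }
    unfold M; nra.
Qed.

Lemma is_derive_Hdot (m : quaternion) (g : R -> quaternion) (x : R)
    (l : quaternion) :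
  is_derive g x l -> is_derive (fun t => Hdot m (g t)) x (Hdot m l).
Proof.
  intros H.
  apply (filterdiff_ext_lin (K := R_AbsRing) (U := R_NormedModule)
    (V := R_NormedModule) _ (fun y : R => Hdot m (scal y l))).
  { exact (filterdiff_comp' g (Hdot m) x _ _ H
      (filterdiff_linear (Hdot m) (is_linear_Hdot m))). }
  intros y.
  exact (linear_scal (Hdot m) (is_linear_Hdot m) y l).
Qed.

Lemma continuous_Hdot (m : quaternion) (g : R * R -> quaternion) (p : R * R) :
  continuous g p -> continuous (fun z => Hdot m (g z)) p.
Proof.
  intros H; apply (continuous_comp g (Hdot m)); [exact H |].
  exact (linear_cont (K := R_AbsRing) (Hdot m) (g p) (is_linear_Hdot m)).
Qed.

Lemma Hdot_ext (p q : quaternion) : (forall m, Hdot m p = Hdot m q) -> p = q.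
Proof.
  intros H; generalize (H (1, 0, 0, 0)) (H (0, 1, 0, 0)) (H (0, 0, 1, 0))
    (H (0, 0, 0, 1)); clear H.
  Hdestruct; simpl; intros; repeat apply (f_equal2 pair); lra.
Qed.

Lemma is_derive_quaternion_unique (g : R -> quaternion) (x : R)
    (l l' : quaternion) :
  is_derive g x l -> is_derive g x l' -> l = l'.
Proof.
  intros H H'; apply Hdot_ext; intros m.
  apply (is_derive_Hdot m), is_derive_unique in H.
  apply (is_derive_Hdot m), is_derive_unique in H'.
  congruence.
Qed.

(* Left multiplication by [I] is skew-adjoint, so [f_y = I f_x] makes
   [<n, f>] and [<I n, f>] conjugate harmonic functions. *)
Lemma slice_cauchy_riemann (f : quaternion -> quaternion)
    (fx fy : R * R -> quaternion) (I n : quaternion) :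
  imaginary_unit I ->
  (forall x y : R, unit_ball (slice_point I x y) ->
    is_slice_dx f I x y (fx (x, y)) /\
    is_slice_dy f I x y (fy (x, y)) /\
    continuous fx (x, y) /\
    continuous fy (x, y) /\
    (RtoH (1 / 2) * (fx (x, y) + I * fy (x, y)) = RtoH 0)%H) ->
  cauchy_riemann (fun x y => Hdot n (f (slice_point I x y)))
    (fun x y => Hdot (I * n)%H (f (slice_point I x y)))
    (fun x y => Hdot n (fx (x, y))) (fun x y => Hdot n (fy (x, y))).
Proof.
  intros HI Hf x y Hxy.
  apply (unit_ball_slice_point I x y HI) in Hxy.
  destruct (Hf x y Hxy) as (Hx & Hy & Cx & Cy & E).
  assert (E1 : fx (x, y) = (- (I * fy (x, y)))%H).
  { revert E; generalize (fx (x, y)) (fy (x, y)); clear; intros p q.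
    Hdestruct; unfold RtoH; simpl; intros E; injection E; intros.
    repeat apply (f_equal2 pair); lra. }
  assert (E2 : Hdot (I * n)%H (fx (x, y)) = - Hdot n (fy (x, y))).
  { rewrite E1; generalize (fy (x, y)); intros q.
    destruct_unit I HI; Hdestruct; simpl.
    match goal with |- _ = - ?r => transitivity (- (r * 1)); [| ring] end.
    rewrite <- HI; ring. }
  assert (E3 : Hdot (I * n)%H (fy (x, y)) = Hdot n (fx (x, y))).
  { rewrite E1; generalize (fy (x, y)); intros q.
    destruct_unit I HI; Hring. }
  split.
  - now apply (is_derive_Hdot n).
  - now apply (is_derive_Hdot n).
  - rewrite <- E2; now apply (is_derive_Hdot (I * n)%H).
  - rewrite <- E3; now apply (is_derive_Hdot (I * n)%H).
  - apply continuity_2d_pt_filterlim.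
    apply (continuous_ext (fun z => Hdot n (fx z))
      (fun z => Hdot n (fx (fst z, snd z))) (x, y)); [now intros [] |].
    now apply continuous_Hdot.
  - apply continuity_2d_pt_filterlim.
    apply (continuous_ext (fun z => Hdot n (fy z))
      (fun z => Hdot n (fy (fst z, snd z))) (x, y)); [now intros [] |].
    now apply continuous_Hdot.
Qed.

Lemma slice_regular_half_space (f : quaternion -> quaternion) (n : quaternion)
    (M : R) :
  slice_regular f -> is_slice_derivative f (RtoH 0) (RtoH 1) ->
  Hdot n n = 1 -> (forall q, unit_ball q -> Hdot n (f q) <= M) ->
  1 / 2 <= M - Hdot n (f (RtoH 0)).
Proof.
  intros Hf Hd Hn HM.
  destruct (slice_point_exists n) as (I & a & b & HI & _ & En).
  destruct (Hf I HI) as (fx & fy & Hxy).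
  assert (CR := slice_cauchy_riemann f fx fy I n HI Hxy).
  assert (E0 : unit_ball (slice_point I 0 0))
    by (apply unit_ball_slice_point; [easy | lra]).
  destruct (Hxy 0 0 E0) as (Dx & Dy & _ & _ & E).
  destruct (Hd I 0 0 HI) as (lx & ly & Dx' & Dy' & E').
  { now rewrite slice_point_0. }
  assert (X := is_derive_quaternion_unique _ _ _ _ Dx' Dx).
  assert (Y := is_derive_quaternion_unique _ _ _ _ Dy' Dy).
  subst lx ly.
  (* Regularity and [f'(0) = 1] together force [f_x = 1] and [f_y = I] at 0. Since [n = a + b I],
     pairing with [n] gives the gradient [(a, b)], which also serves as the direction in
     [harnack_gradient]. *)
  assert (F : Hdot n (fx (0, 0)) = a /\ Hdot n (fy (0, 0)) = b /\
    a ^ 2 + b ^ 2 = 1).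
  { revert E E'; generalize (fx (0, 0)) (fy (0, 0)); intros p q E E'.
    assert (Hp : p = RtoH 1).
    { clear - E E'; Hdestruct; unfold RtoH in *; simpl in *.
      injection E; injection E'; intros; repeat apply (f_equal2 pair); lra. }
    assert (Hq : (I * q = - RtoH 1)%H).
    { clear - E E'; Hdestruct; unfold RtoH in *; simpl in *.
      injection E; injection E'; intros; repeat apply (f_equal2 pair); lra. }
    assert (Hq' : q = I).
    { transitivity (- (I * (I * q)))%H; [| rewrite Hq; unfold RtoH; Hring].
      clear - HI; destruct_unit I HI.
      transitivity (RtoH 1 * q)%H; [| rewrite <- HI]; unfold RtoH; Hring. }
    subst p q n; clear - HI Hn; destruct_unit I HI.
    rewrite slice_point_coords in *; unfold RtoH; simpl in *.
    split; [ring |]; split.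
    - transitivity (b * (0 * 0 + b0 * b0 + c * c + d * d)); [ring |].
      rewrite HI; ring.
    - transitivity (a ^ 2 + b ^ 2 * (0 * 0 + b0 * b0 + c * c + d * d)).
      + rewrite HI; ring.
      + rewrite <- Hn; ring. }
  destruct F as (Fx & Fy & Fab).
  assert (G := harnack_gradient _ _ _ _ a b M CR Fab).
  simpl in G; rewrite Fx, Fy, slice_point_0 in G.
  assert (U : forall x y : R, x ^ 2 + y ^ 2 < 1 ->
    Hdot n (f (slice_point I x y)) <= M).
  { intros x y H; apply HM; now apply unit_ball_slice_point. }
  generalize (G U); nra.
Qed.

Lemma unit_ball_0 : unit_ball (RtoH 0).
Proof.
  unfold unit_ball; rewrite Hmod_dot; simpl.
  rewrite <- sqrt_1; apply sqrt_lt_1_alt; lra.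
Qed.

Lemma convex_image_ball (f : quaternion -> quaternion) (w : quaternion) :
  slice_regular f -> is_slice_derivative f (RtoH 0) (RtoH 1) ->
  convex (image_ball f) -> Hmod (w - f (RtoH 0))%H < 1 / 2 -> image_ball f w.
Proof.
  intros Hf Hd HK; apply convex_ball_of_support; [easy | |].
  - exists (f (RtoH 0)), (RtoH 0); split; [apply unit_ball_0 | easy].
  - intros n M Hn HM; apply slice_regular_half_space; auto.
    intros q Hq; apply HM; now exists q.
Qed.

(** * The slice extension of artanh *)

(* [artanh z = (1/2) log ((1 + z) / (1 - z))], and [(1 + z) / (1 - z)] has the
   argument of [(1 + z) (1 - conj z) = 1 - x^2 - y^2 + 2 i y], whose real part
   is positive on the disk. *)
Definition artanh_re (x y : R) : R :=
  / 4 * (ln ((1 + x) ^ 2 + y ^ 2) - ln ((1 - x) ^ 2 + y ^ 2)).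

Definition artanh_im (x y : R) : R :=
  / 2 * atan (2 * y / (1 - x ^ 2 - y ^ 2)).

(** Off the real axis the imaginary unit of the slice is [(b, c, d) / y], and its denominator is
    absorbed in [v]. On the real axis [v] is a division by zero, but it multiplies
    [b = c = d = 0]. *)
Definition slice_artanh (q : quaternion) : quaternion :=
  let '(a, b, c, d) := q in
  let y := sqrt (b ^ 2 + c ^ 2 + d ^ 2) in
  let v := artanh_im a y / y in
  (artanh_re a y, v * b, v * c, v * d).

(* The derivative [1 / (1 - z^2)] is [artanh_d_re + i artanh_d_im]. *)
Definition artanh_modulus (x y : R) : R :=
  ((1 + x) ^ 2 + y ^ 2) * ((1 - x) ^ 2 + y ^ 2).
Definition artanh_d_re (x y : R) : R :=
  (1 - x ^ 2 + y ^ 2) / artanh_modulus x y.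
Definition artanh_d_im (x y : R) : R := 2 * x * y / artanh_modulus x y.

Lemma disk_bounds (x y : R) : x ^ 2 + y ^ 2 < 1 ->
  0 < (1 + x) ^ 2 + y ^ 2 /\ 0 < (1 - x) ^ 2 + y ^ 2.
Proof. intros H; split; nra. Qed.

Lemma artanh_im_opp (x y : R) : artanh_im x (- y) = - artanh_im x y.
Proof.
  unfold artanh_im.
  replace (2 * - y / (1 - x ^ 2 - (- y) ^ 2))
    with (- (2 * y / (1 - x ^ 2 - y ^ 2)))
    by (replace ((- y) ^ 2) with (y ^ 2) by ring; unfold Rdiv; ring).
  rewrite atan_opp; ring.
Qed.

Lemma artanh_im_bound (x y : R) : Rabs (artanh_im x y) < PI / 4.
Proof.
  unfold artanh_im; generalize (atan_bound (2 * y / (1 - x ^ 2 - y ^ 2))).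
  intros H; apply Rabs_def1; lra.
Qed.

(** The definition always uses the nonnegative imaginary part; for [y < 0] the oddness of
    [artanh_im] in [y] compensates the change from [I] to [- I]. *)
Lemma slice_artanh_slice (I : quaternion) (x y : R) : imaginary_unit I ->
  slice_artanh (slice_point I x y)
  = slice_point I (artanh_re x y) (artanh_im x y).
Proof.
  intros HI; destruct_unit I HI; rewrite !slice_point_coords; simpl.
  replace (_ + _ + _) with (y ^ 2); cycle 1.
  { transitivity (y ^ 2 * (0 * 0 + b * b + c * c + d * d)); [| ring].
    rewrite HI; ring. }
  destruct (Rtotal_order y 0) as [H | [-> | H]].
  - replace (y ^ 2) with ((- y) ^ 2) by ring; rewrite sqrt_pow2 by lra.
    rewrite artanh_im_opp; unfold artanh_re.
    replace ((- y) ^ 2) with (y ^ 2) by ring.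
    repeat apply (f_equal2 pair); try easy; field; lra.
  - replace (0 ^ 2) with 0 by ring; rewrite sqrt_0.
    replace (artanh_im x 0) with 0
      by (unfold artanh_im, Rdiv; rewrite Rmult_0_r, Rmult_0_l, atan_0; ring).
    repeat apply (f_equal2 pair); try easy; ring.
  - rewrite sqrt_pow2 by lra.
    repeat apply (f_equal2 pair); try easy; field; lra.
Qed.

Lemma is_derive_artanh (x y : R) : x ^ 2 + y ^ 2 < 1 ->
  is_derive (fun t => artanh_re t y) x (artanh_d_re x y) /\
  is_derive (artanh_re x) y (- artanh_d_im x y) /\
  is_derive (fun t => artanh_im t y) x (artanh_d_im x y) /\
  is_derive (artanh_im x) y (artanh_d_re x y).
Proof.
  intros H; destruct (disk_bounds x y H) as [H1 H2].
  (* Both sides are [|1 - z^2|^2]; the left one is the denominator that differentiating [atan]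
     produces. *)
  assert (E : (1 - x ^ 2 - y ^ 2) ^ 2 + 4 * y ^ 2 = artanh_modulus x y)
    by (unfold artanh_modulus; ring).
  assert (N : 0 < artanh_modulus x y) by now apply Rmult_lt_0_compat.
  unfold artanh_d_re, artanh_d_im; split; [| split; [| split]].
  - unfold artanh_re; auto_derive; [simpl in *; repeat split; lra |].
    unfold artanh_modulus; field; simpl in *; lra.
  - unfold artanh_re; auto_derive; [simpl in *; repeat split; lra |].
    unfold artanh_modulus; field; simpl in *; lra.
  - unfold artanh_im; auto_derive; [simpl in *; lra |].
    rewrite <- E; field; simpl in *; repeat split; nra.
  - unfold artanh_im; auto_derive; [simpl in *; lra |].
    rewrite <- E; field; simpl in *; repeat split; nra.
Qed.

Lemma continuity_2d_pt_pow (f : R -> R -> R) (n : nat) (x y : R) :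
  continuity_2d_pt f x y -> continuity_2d_pt (fun a b => f a b ^ n) x y.
Proof.
  intros H; induction n as [| n IH]; simpl.
  - apply continuity_2d_pt_const.
  - now apply continuity_2d_pt_mult.
Qed.

Lemma continuity_2d_pt_div (f g : R -> R -> R) (x y : R) :
  continuity_2d_pt f x y -> continuity_2d_pt g x y -> g x y <> 0 ->
  continuity_2d_pt (fun a b => f a b / g a b) x y.
Proof.
  intros Hf Hg H0; apply continuity_2d_pt_mult; [easy |].
  now apply continuity_2d_pt_inv.
Qed.

Lemma continuity_artanh_d (x y : R) : x ^ 2 + y ^ 2 < 1 ->
  continuity_2d_pt artanh_d_re x y /\ continuity_2d_pt artanh_d_im x y.
Proof.
  intros H; destruct (disk_bounds x y H) as [H1 H2].
  assert (N : artanh_modulus x y <> 0)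
    by (apply Rgt_not_eq; now apply Rmult_lt_0_compat).
  split; apply continuity_2d_pt_div; try easy; unfold artanh_modulus;
    repeat first [ apply continuity_2d_pt_minus | apply continuity_2d_pt_plus
      | apply continuity_2d_pt_mult | apply continuity_2d_pt_pow
      | apply continuity_2d_pt_id1 | apply continuity_2d_pt_id2
      | apply continuity_2d_pt_const ].
Qed.

Lemma slice_point_scal (I : quaternion) (x y : R) :
  slice_point I x y = plus (scal x (RtoH 1)) (scal y I).
Proof. rewrite Hplus_plus, !Hmult_scal; unfold slice_point, RtoH; Hring. Qed.

Lemma is_derive_slice_point (I : quaternion) (a b : R -> R) (t la lb : R) :
  is_derive a t la -> is_derive b t lb ->
  is_derive (fun s => slice_point I (a s) (b s)) t (slice_point I la lb).
Proof.
  intros Ha Hb; rewrite slice_point_scal.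
  apply (is_derive_ext (fun s => plus (scal (a s) (RtoH 1)) (scal (b s) I))).
  { intros s; now rewrite slice_point_scal. }
  exact (is_derive_plus _ _ _ _ _ (is_derive_scal_l a t la (RtoH 1) Ha)
    (is_derive_scal_l b t lb I Hb)).
Qed.

Lemma continuous_slice_point (I : quaternion) (a b : R -> R -> R) (x y : R) :
  continuity_2d_pt a x y -> continuity_2d_pt b x y ->
  continuous (fun p : R * R =>
    slice_point I (a (fst p) (snd p)) (b (fst p) (snd p))) (x, y).
Proof.
  rewrite !continuity_2d_pt_filterlim; intros Ha Hb.
  apply (continuous_ext (fun p : R * R =>
    plus (scal (a (fst p) (snd p)) (RtoH 1)) (scal (b (fst p) (snd p)) I))).
  { intros p; now rewrite slice_point_scal. }
  exact (continuous_plus _ _ _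
    (continuous_scal_l (fun p : R * R => a (fst p) (snd p)) (RtoH 1) (x, y) Ha)
    (continuous_scal_l (fun p : R * R => b (fst p) (snd p)) I (x, y) Hb)).
Qed.

Lemma slice_artanh_dx (I : quaternion) (x y : R) :
  imaginary_unit I -> x ^ 2 + y ^ 2 < 1 ->
  is_slice_dx slice_artanh I x y
    (slice_point I (artanh_d_re x y) (artanh_d_im x y)).
Proof.
  intros HI H; destruct (is_derive_artanh x y H) as (H1 & _ & H3 & _).
  apply (is_derive_ext (fun t => slice_point I (artanh_re t y) (artanh_im t y))).
  - intros t; now rewrite slice_artanh_slice.
  - now apply (is_derive_slice_point I (fun t => artanh_re t y)
      (fun t => artanh_im t y)).
Qed.

Lemma slice_artanh_dy (I : quaternion) (x y : R) :
  imaginary_unit I -> x ^ 2 + y ^ 2 < 1 ->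
  is_slice_dy slice_artanh I x y
    (slice_point I (- artanh_d_im x y) (artanh_d_re x y)).
Proof.
  intros HI H; destruct (is_derive_artanh x y H) as (_ & H2 & _ & H4).
  apply (is_derive_ext (fun t => slice_point I (artanh_re x t) (artanh_im x t))).
  - intros t; now rewrite slice_artanh_slice.
  - now apply (is_derive_slice_point I (artanh_re x) (artanh_im x)).
Qed.

Lemma slice_point_mul_unit (I : quaternion) (x y : R) :
  imaginary_unit I -> (I * slice_point I x y)%H = slice_point I (- y) x.
Proof.
  intros HI; destruct_unit I HI; rewrite !slice_point_coords; simpl.
  repeat apply (f_equal2 pair); try ring.
  transitivity (- y * (0 * 0 + b * b + c * c + d * d)); [ring |].
  rewrite HI; ring.
Qed.

Lemma slice_artanh_regular : slice_regular slice_artanh.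
Proof.
  intros I HI.
  exists (fun p => slice_point I (artanh_d_re (fst p) (snd p))
                                 (artanh_d_im (fst p) (snd p))).
  exists (fun p => slice_point I (- artanh_d_im (fst p) (snd p))
                                 (artanh_d_re (fst p) (snd p))).
  intros x y Hxy; apply (unit_ball_slice_point I x y HI) in Hxy.
  destruct (continuity_artanh_d x y Hxy) as [C1 C2].
  split; [| split; [| split; [| split]]].
  - now apply slice_artanh_dx.
  - now apply slice_artanh_dy.
  - now apply continuous_slice_point.
  - apply (continuous_slice_point I (fun a b => - artanh_d_im a b)); [| easy].
    now apply continuity_2d_pt_opp.
  - rewrite slice_point_mul_unit by easy; simpl.
    generalize (artanh_d_re x y) (artanh_d_im x y); intros.
    unfold slice_point, RtoH; Hring.
Qed.

Lemma slice_point_eq_0 (I : quaternion) (x y : R) :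
  imaginary_unit I -> RtoH 0 = slice_point I x y -> x = 0 /\ y = 0.
Proof.
  intros HI E; apply (f_equal (fun p => Hmod p ^ 2)) in E.
  rewrite Hmod_slice_point, pow2_sqrt, Hmod_sqr in E by nra || easy.
  unfold RtoH in E; simpl in E; nra.
Qed.

Lemma slice_artanh_derivative_0 :
  is_slice_derivative slice_artanh (RtoH 0) (RtoH 1).
Proof.
  intros I x y HI E.
  destruct (slice_point_eq_0 I x y HI E) as [-> ->].
  exists (slice_point I (artanh_d_re 0 0) (artanh_d_im 0 0)).
  exists (slice_point I (- artanh_d_im 0 0) (artanh_d_re 0 0)).
  split; [apply slice_artanh_dx; [easy | lra] |].
  split; [apply slice_artanh_dy; [easy | lra] |].
  rewrite slice_point_mul_unit by easy.
  replace (artanh_d_re 0 0) with 1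
    by (unfold artanh_d_re, artanh_modulus; field).
  replace (artanh_d_im 0 0) with 0
    by (unfold artanh_d_im, artanh_modulus; field).
  unfold slice_point, RtoH; Hdestruct; simpl; repeat apply (f_equal2 pair); field.
Qed.

Lemma artanh_surjective (X Y : R) : Rabs Y < PI / 4 ->
  exists x y, x ^ 2 + y ^ 2 < 1 /\ artanh_re x y = X /\ artanh_im x y = Y.
Proof.
  intros HY; apply Rabs_def2 in HY.
  set (E := exp (2 * X)). set (C := cos (2 * Y)). set (S := sin (2 * Y)).
  assert (HE : 0 < E) by apply exp_pos.
  (* This is where the width of the strip enters: [zeta] lies in the right half-plane, so its Cayley
     transform lies in the disk. *)
  assert (HC : 0 < C) by (apply cos_gt_0; lra).
  assert (HCS : S * S + C * C = 1) by (apply sin2_cos2).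
  assert (HT : 0 < E ^ 2 + 1 + 2 * C * E) by nra.
  set (T := E ^ 2 + 1 + 2 * C * E) in *.
  (* [x + i y = tanh (X + i Y) = (zeta - 1) / (zeta + 1)] with
     [zeta = E (C + i S)], and [T = |zeta + 1|^2]. *)
  set (x := (E ^ 2 - 1) / T). set (y := 2 * E * S / T).
  assert (N1 : (1 + x) ^ 2 + y ^ 2 = 4 * E ^ 2 / T).
  { transitivity (((T + E ^ 2 - 1) ^ 2 + 4 * E ^ 2 * (S * S)) / T ^ 2);
      [unfold x, y; field; lra |].
    replace (S * S) with (1 - C * C) by lra.
    replace (_ + _) with (4 * E ^ 2 * T) by (unfold T; ring); field; lra. }
  assert (N2 : (1 - x) ^ 2 + y ^ 2 = 4 / T).
  { transitivity (((T - E ^ 2 + 1) ^ 2 + 4 * E ^ 2 * (S * S)) / T ^ 2);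
      [unfold x, y; field; lra |].
    replace (S * S) with (1 - C * C) by lra.
    replace (_ + _) with (4 * T) by (unfold T; ring); field; lra. }
  (* Parallelogram law: [|1 + z|^2 + |1 - z|^2 = 2 + 2 |z|^2]. *)
  assert (D : 1 - x ^ 2 - y ^ 2 = 4 * C * E / T).
  { transitivity (2 - (((1 + x) ^ 2 + y ^ 2) + ((1 - x) ^ 2 + y ^ 2)) / 2);
      [field |].
    rewrite N1, N2; transitivity ((2 * T - 2 * E ^ 2 - 2) / T);
      [field; lra |].
    unfold T at 1; field; lra. }
  assert (IT : 0 < / T) by now apply Rinv_0_lt_compat.
  exists x, y; split; [| split].
  - assert (0 < 4 * C * E / T) by (apply Rmult_lt_0_compat; nra); lra.
  - unfold artanh_re; rewrite N1, N2.
    replace (4 * E ^ 2 / T) with (E ^ 2 * (4 / T)) by (field; lra).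
    rewrite ln_mult; [| nra | apply Rmult_lt_0_compat; lra].
    replace (E ^ 2) with (exp (4 * X))
      by (unfold E; simpl; rewrite Rmult_1_r, <- exp_plus; f_equal; ring).
    rewrite ln_exp; field.
  - unfold artanh_im; rewrite D.
    replace (2 * y / (4 * C * E / T)) with (tan (2 * Y))
      by (unfold tan, y; fold S; fold C; field; lra).
    rewrite atan_tan by lra; field.
Qed.

(** * The image of artanh: a tube around the real axis *)

Definition Him (p : quaternion) : quaternion :=
  let '(_, b, c, d) := p in (0, b, c, d).

Lemma Him_slice_point (I : quaternion) (x y : R) :
  imaginary_unit I -> Hmod (Him (slice_point I x y)) = Rabs y.
Proof.
  intros HI; transitivity (Hmod (slice_point I 0 y)).
  - f_equal; destruct_unit I HI; now rewrite !slice_point_coords.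
  - rewrite Hmod_slice_point by easy.
    replace (0 ^ 2 + y ^ 2) with (Rsqr y) by (unfold Rsqr; ring).
    apply sqrt_Rsqr_abs.
Qed.

Lemma image_slice_artanh (w : quaternion) :
  image_ball slice_artanh w <-> Hmod (Him w) < PI / 4.
Proof.
  split.
  - intros (q & Hq & <-).
    destruct (slice_point_exists q) as (I & x & y & HI & _ & ->).
    rewrite slice_artanh_slice, Him_slice_point by easy.
    apply artanh_im_bound.
  - destruct (slice_point_exists w) as (I & X & Y & HI & _ & ->).
    rewrite Him_slice_point by easy; intros HY.
    destruct (artanh_surjective X Y HY) as (x & y & Hxy & <- & <-).
    exists (slice_point I x y); split.
    + now apply unit_ball_slice_point.
    + now apply slice_artanh_slice.
Qed.

Lemma Hmod_scal (t : R) (p : quaternion) :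
  Hmod (RtoH t * p)%H = Rabs t * Hmod p.
Proof.
  rewrite <- sqrt_Rsqr_abs, !Hmod_dot, <- sqrt_mult;
    [| apply Rle_0_sqr | apply Hdot_pos].
  f_equal; unfold Rsqr; Hring.
Qed.

Lemma slice_artanh_convex : convex (image_ball slice_artanh).
Proof.
  intros p q t; rewrite !image_slice_artanh; intros Hp Hq Ht.
  replace (Him (RtoH (1 - t) * p + RtoH t * q))%H
    with (RtoH (1 - t) * Him p + RtoH t * Him q)%H by (unfold RtoH; Hring).
  eapply Rle_lt_trans; [apply Hmod_triangle |].
  rewrite !Hmod_scal, !Rabs_pos_eq by lra.
  destruct (Rle_lt_dec t (1 / 2)); nra.
Qed.

Lemma radius_slice_artanh :
  Rbar_le (radius slice_artanh) (Finite (PI / 4)).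
Proof.
  unfold radius; apply (proj2 (proj2_sig (Rbar_ex_lub _))).
  intros r (a & Ha & ->); unfold radius_at.
  apply (proj2 (Lub_Rbar_correct _)); intros rho [Hrho Hball]; simpl.
  destruct (Rle_lt_dec rho (PI / 4)) as [| L]; [easy | exfalso].
  assert (P := PI_RGT_0).
  destruct (slice_point_exists (slice_artanh a)) as (I & X & Y & HI & HY & E).
  (* This point is at distance exactly [PI / 4 < rho] from the centre, but since [Y >= 0] its
     imaginary part has modulus at least [PI / 4], outside the tube. *)
  assert (W : image_ball slice_artanh (slice_point I X (Y + PI / 4))).
  { apply Hball; rewrite E.
    replace (slice_point I X (Y + PI / 4) - slice_point I X Y)%H
      with (slice_point I 0 (PI / 4)) by (unfold slice_point, RtoH; Hring).
    rewrite Hmod_slice_point by easy.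
    replace (0 ^ 2 + (PI / 4) ^ 2) with ((PI / 4) ^ 2) by ring.
    rewrite sqrt_pow2; lra. }
  apply image_slice_artanh in W.
  rewrite Him_slice_point, Rabs_pos_eq in W by easy || lra; lra.
Qed.

Theorem theorem6p6 :
  Rbar_le (Finite (1 / 2)) convex_bloch_constant /\
  Rbar_le convex_bloch_constant (Finite (PI / 4)).
Proof.
  unfold convex_bloch_constant; split.
  - apply (proj2 (proj2_sig (Rbar_ex_glb _))).
    intros r (f & Hf & Hd & HK & ->).
    (* The centre [a = 0], where the derivative is normalized, already gives radius at least 1/2. *)
    apply Rbar_le_trans with (radius_at (RtoH 0) f).
    + apply (proj1 (Lub_Rbar_correct _)); split; [lra |].
      intros w; now apply convex_image_ball.
    + apply (proj1 (proj2_sig (Rbar_ex_lub _))); exists (RtoH 0); split; [| easy].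
      apply unit_ball_0.
  - apply Rbar_le_trans with (radius slice_artanh);
      [| exact radius_slice_artanh].
    apply (proj1 (proj2_sig (Rbar_ex_glb _))); exists slice_artanh.
    auto using slice_artanh_regular, slice_artanh_derivative_0,
      slice_artanh_convex.
Qed.
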